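(* Assume strong ignorability: $(Y^0,Y^1)\perp\!\!\!\perp A\mid X$ and $0<e(x)<1$ for all $x$. (a) (Double robustness) If in addition monotonicity $Y^0\le Y^1$ holds, then $$\hat\gamma_{mono}=\frac{\frac1n\sum_{i=1}^n\Big\{(1-A_i)Y_i-\frac{A_i}{\hat e(X_i)}(1-\hat e(X_i))(Y_i-\hat\mu_1(X_i))+\hat\mu_1(X_i)(A_i-1)\Big\}}{\frac1n\sum_{i=1}^n(1-A_i)(Y_i-1)}$$ is a consistent estimator of $\gamma$ if one of the following conditions is satisfied: (i) the propensity score model is correctly specified; (ii) the outcome regression model is correctly specified. (b) (Single robustness) If instead in addition conditional independence $Y^0\perp\!\!\!\perp Y^1\mid X$ holds, then $$\hat\gamma_{inde}=\frac{\frac1n\sum_{i=1}^n\Big\{\hat\mu_1(X_i)(1-Y_i)(A_i-1)-\frac{A_i}{\hat e(X_i)}(1-\hat e(X_i))(Y_i-\hat\mu_1(X_i))(1-\hat\mu_0(X_i))\Big\}}{\frac1n\sum_{i=1}^n(1-Y_i)(A_i-1)}$$ is a consistent estimator of $\gamma$, regardless of whether the propensity score model is correctly specified, provided that the outcome regression model is correctly specified.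
   Context: Setting: $X$ is a $p$-dimensional covariate vector, $A\in\{0,1\}$ a binary cause, $Y\in\{0,1\}$ a binary outcome, $Y^0,Y^1\in\{0,1\}$ the potential outcomes, with $Y=AY^1+(1-A)Y^0$. The data $(X_i,A_i,Y_i)$, $i=1,\dots,n$, are i.i.d. copies of $(X,A,Y)$. The propensity score is $e(x)=\mathbb{P}(A=1\mid X=x)$; the outcome regressions are $\mu_a(x)=\mathbb{P}(Y=1\mid X=x,A=a)$, $a=0,1$. The probability of sufficient causation is $\gamma=\mathbb{P}(Y^1=1\mid A=0,Y=0)$, where $\mathbb{P}(A=0,Y=0)>0$. Nuisance estimators: $\hat e,\hat\mu_0,\hat\mu_1$ are estimators of $e,\mu_0,\mu_1$ from working models, obtained by cross-fitting: the sample is split into $K$ equal folds, and for $i$ in fold $k$ the values $\hat e(X_i),\hat\mu_0(X_i),\hat\mu_1(X_i)$ are predictions from estimators trained on the data outside fold $k$. As $n\to\infty$ the working-model estimators $\hat e,\hat\mu_0,\hat\mu_1$ have limits $\bar e,\bar m_0,\bar m_1$ (possibly different from the truth), in the sense that the sample averages in the numerators of the estimators converge in probability to the corresponding expectations with $\hat e,\hat\mu_0,\hat\mu_1$ replaced by $\bar e,\bar m_0,\bar m_1$, with $0<\bar e<1$. The propensity score model is correctly specified if $\bar e=e$; the outcome regression model is correctly specified if $\bar m_a=\mu_a$ for $a=0,1$. Consistency means convergence in probability to $\gamma$. *)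

(* Defs.v *)
From HB Require Import structures.
From mathcomp Require Import all_boot all_order all_algebra.
From mathcomp Require Import all_classical all_reals all_analysis.

Set Implicit Arguments.
Unset Strict Implicit.
Unset Printing Implicit Defensive.

Import Order.TTheory GRing.Theory Num.Theory.
Import numFieldNormedType.Exports.

Local Open Scope classical_set_scope.
Local Open Scope ring_scope.

(* An observation ((x, a), y): covariates in R^p (with the product sigma-
   algebra), binary cause, binary outcome. *)
Notation datum R p := (p.-tuple R * bool * bool)%type.

Section probability_notions.
Context d (T : measurableType d) (R : realType) (P : probability T R).

Definition cond_pr (E F : set T) : R := fine (P (E `&` F)) / fine (P F).

(* g is a version of z |-> P(E | Z = z); versions are unique almost surely. *)
Definition is_cond_prob d' (S : measurableType d') (Z : T -> S) (E : set T)
    (g : S -> R) : Prop :=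
  [/\ measurable_fun [set: S] g,
      P.-integrable [set: T] (fun w => (g (Z w))%:E) &
      forall B : set S, measurable B ->
        (\int[P]_(w in Z @^-1` B) (g (Z w))%:E)%E = P (E `&` Z @^-1` B)].

(* P(U in B, V in C | Z) = P(U in B | Z) P(V in C | Z) almost surely. *)
Definition cond_indep d' (S : measurableType d') (Z : T -> S)
    d1 (S1 : measurableType d1) (U : T -> S1)
    d2 (S2 : measurableType d2) (V : T -> S2) : Prop :=
  forall (B : set S1) (C : set S2), measurable B -> measurable C ->
  exists f g : S -> R,
    [/\ is_cond_prob Z (U @^-1` B) f, is_cond_prob Z (V @^-1` C) g &
        is_cond_prob Z (U @^-1` B `&` V @^-1` C) (fun z => f z * g z)].

Definition mutually_indep d' (S : measurableType d') (D : nat -> T -> S) :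
    Prop :=
  forall (s : seq nat) (B : nat -> set S), uniq s ->
    (forall i, measurable (B i)) ->
    P (\bigcap_(i in [set` s]) (D i @^-1` B i)) =
      (\prod_(i <- s) P (D i @^-1` B i))%E.

Definition iid_copies d' (S : measurableType d') (D : nat -> T -> S)
    (Z : T -> S) : Prop :=
  mutually_indep D /\
  forall i (B : set S), measurable B -> P (D i @^-1` B) = P (Z @^-1` B).

Definition cvg_in_prob (V : nat -> T -> R) (c : R) : Prop :=
  forall eps : R, 0 < eps ->
    P [set w | eps < `|V n w - c|] @[n --> \oo] --> 0%E.

(* Integrability is part of the notion: the limiting expectation exists. *)
Definition cvg_in_prob_to_mean (V : nat -> T -> R) (phi : T -> R) : Prop :=
  P.-integrable [set: T] (EFin \o phi) /\
  cvg_in_prob V (fine 'E_P[phi]).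

End probability_notions.

Section estimators.
Context (R : realType) (p : nat).

(* A fitting procedure maps a training sample to a prediction function. *)
Definition measurable_procedure (fit : seq (datum R p) -> p.-tuple R -> R) :
    Prop :=
  forall m, measurable_fun [set: m.-tuple (datum R p) * p.-tuple R]
    (fun z => fit (tval z.1) z.2).

(* fold n i is the fold of observation i < n when the sample size is n.
   Folds are equal when K divides n, and differ by at most one otherwise. *)
Definition equal_folds (K : nat) (fold : forall n, 'I_n -> 'I_K) : Prop :=
  forall n (k : 'I_K),
    (n %/ K <= #|[pred i : 'I_n | fold n i == k]| <= (n %/ K).+1)%N.

Definition mono_summand (e m1 : R) (a y : bool) : R :=
  (1 - a%:R) * y%:R - a%:R / e * (1 - e) * (y%:R - m1) + m1 * (a%:R - 1).

Definition inde_summand (e m0 m1 : R) (a y : bool) : R :=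
  m1 * (1 - y%:R) * (a%:R - 1)
  - a%:R / e * (1 - e) * (y%:R - m1) * (1 - m0).

Context (T : Type) (D : nat -> T -> datum R p).

Definition covariates i w : p.-tuple R := (D i w).1.1.
Definition cause i w : bool := (D i w).1.2.
Definition outcome i w : bool := (D i w).2.

Definition sample_mean n (f : 'I_n -> R) : R := n%:R^-1 * \sum_(i < n) f i.

Context (K : nat) (fold : forall n, 'I_n -> 'I_K).

Definition training_data n (k : 'I_K) (w : T) : seq (datum R p) :=
  [seq D i w | i : 'I_n <- enum 'I_n & fold i != k].

Definition cross_fit (fit : seq (datum R p) -> p.-tuple R -> R) n (i : 'I_n)
    (w : T) : R :=
  fit (training_data n (fold i) w) (covariates i w).

Context (fit_e : seq (datum R p) -> p.-tuple R -> R)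
  (fit_mu : bool -> seq (datum R p) -> p.-tuple R -> R).

Definition mono_numerator n w : R :=
  sample_mean (fun i : 'I_n =>
    mono_summand (cross_fit fit_e i w) (cross_fit (fit_mu true) i w)
      (cause i w) (outcome i w)).

Definition mono_denominator n w : R :=
  sample_mean (fun i : 'I_n => (1 - (cause i w)%:R) * ((outcome i w)%:R - 1)).

Definition gamma_mono n w : R := mono_numerator n w / mono_denominator n w.

Definition inde_numerator n w : R :=
  sample_mean (fun i : 'I_n =>
    inde_summand (cross_fit fit_e i w) (cross_fit (fit_mu false) i w)
      (cross_fit (fit_mu true) i w) (cause i w) (outcome i w)).

Definition inde_denominator n w : R :=
  sample_mean (fun i : 'I_n => (1 - (outcome i w)%:R) * ((cause i w)%:R - 1)).

Definition gamma_inde n w : R := inde_numerator n w / inde_denominator n w.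

End estimators.

(* Main.v *)
(* Each correction term has the form [h(Z) (1_E - P(E | Z))], hence mean 0 as
   soon as it is integrable.
   - If the propensity score is correct, ignorability gives
     [E[A (1 - e(X)) / e(X) Y^1] = P(A = 0, Y^1 = 1)], and the terms in the
     limit [m_1] of the outcome regression add up to [m_1(X) / e(X) (A - e(X))].
   - If the outcome regression is correct, the inverse-propensity term is
     [h(X, A) (Y - mu_A(X))], and overlap makes [mu_1(X)] a version of
     [P(Y^1 = 1 | X)], not merely on [A = 1].
   In each case the numerator tends to [- P(A = 0, Y^0 = 0, Y^1 = 1)]: under
   monotonicity this is [P(A = 0, Y^0 = 1) - P(A = 0, Y^1 = 1)], and under
   conditional independence [P(Y^0 = 0, Y^1 = 1 | X)] is a product.  The
   denominator tends to [- P(A = 0, Y = 0)] by the weak law of large numbers. *)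
Require Import Defs.
From HB Require Import structures.
From mathcomp Require Import all_boot all_order all_algebra.
From mathcomp Require Import all_classical all_reals all_analysis.
From mathcomp Require Import measurable_realfun ring.

Set Implicit Arguments.
Unset Strict Implicit.
Unset Printing Implicit Defensive.

Import Order.TTheory GRing.Theory Num.Theory.
Import numFieldNormedType.Exports.

Local Open Scope classical_set_scope.
Local Open Scope ring_scope.

(** * Measurability of Boolean events and of inversion *)

Lemma measurable_eq_true d (T : measurableType d) (b : T -> bool) :
  measurable_fun [set: T] b -> measurable [set w | b w = true].
Proof.
move=> mb; rewrite -[X in measurable X]setTI.
exact: (mb measurableT [set true]).
Qed.

Lemma indic_eq_true (T : Type) (R : pzRingType) (b : T -> bool) (w : T) :
  \1_[set w | b w = true] w = (b w)%:R :> R.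
Proof.
by rewrite indicE; congr (nat_of_bool _)%:R; apply/idP/idP; rewrite inE.
Qed.

(** Inversion is written as [x * (|x|^-1)^2], where [|x|^-1] is a real power; the identity survives
    at [0] because [0^-1 = 0]. *)
Lemma inv_measurable (R : realType) (D : set R) :
  measurable_fun D (@GRing.inv R).
Proof.
apply: measurable_funTS.
rewrite (_ : @GRing.inv R = fun x => x * (`|x| `^ (- 1)) ^+ 2); last first.
  apply/funext => x; rewrite powR_inv1// exprVn real_normK ?num_real// expr2.
  by have [->|x0] := eqVneq x 0; [rewrite mul0r invr0|field].
apply: measurable_funM => //; apply: measurable_funX.
exact: (measurableT_comp (measurable_powR _)).
Qed.

Lemma measurable_fun_bool2 (g : bool * bool -> bool) :
  measurable_fun [set: bool * bool] g.
Proof.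
rewrite (_ : g = fun z => if z.1 then if z.2 then g (true, true)
  else g (true, false) else if z.2 then g (false, true) else g (false, false)).
  by apply: measurable_fun_ifT => //; apply: measurable_fun_ifT.
by apply/funext => -[[] []].
Qed.

(** * Integrable functions with a known mean *)

Section means.
Context d (T : measurableType d) (R : realType) (P : probability T R).
Implicit Types (f g : T -> R) (c : R).

(** Bundling integrability with the value lets means be added and scaled without separate finiteness
    conditions. *)
Definition has_mean f c : Prop :=
  P.-integrable [set: T] (EFin \o f) /\ (\int[P]_w (f w)%:E = c%:E)%E.

Lemma has_mean_measurable f c : has_mean f c -> measurable_fun [set: T] f.
Proof. by case=> /measurable_int/measurable_EFinP. Qed.

Lemma has_mean_fine f c : has_mean f c -> fine ('E_P[f])%E = c.
Proof. by case=> _ fc; rewrite unlock fc. Qed.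

Lemma has_mean_unique f c c' : has_mean f c -> has_mean f c' -> c = c'.
Proof. by case=> _ fc [_ fc']; apply: EFin_inj; rewrite -fc. Qed.

Lemma has_meanD f g c c' : has_mean f c -> has_mean g c' ->
  has_mean (fun w => f w + g w) (c + c').
Proof.
move=> [fi fc] [gi gc]; split; first exact: (integrableD _ fi gi).
under eq_integral do rewrite EFinD.
by rewrite integralD// fc gc.
Qed.

Lemma has_meanZ f k c : has_mean f c -> has_mean (fun w => k * f w) (k * c).
Proof.
move=> [fi fc]; split; first exact: (integrableZl _ k fi).
under eq_integral do rewrite EFinM.
by rewrite integralZl// fc.
Qed.

Lemma has_meanB f g c c' : has_mean f c -> has_mean g c' ->
  has_mean (fun w => f w - g w) (c - c').
Proof.
move=> fc gc; rewrite -(mulN1r c').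
under eq_fun do rewrite -mulN1r.
by apply: has_meanD => //; exact: has_meanZ.
Qed.

Lemma has_mean_cst c : has_mean (fun=> c) c.
Proof.
split; first exact: finite_measure_integrable_cst.
rewrite integral_cst//= -[RHS]mule1; congr (_ * _)%E.
exact: probability_setT.
Qed.

Lemma has_mean_indic (E : set T) : measurable E ->
  has_mean (\1_E : T -> R) (fine (P E)).
Proof.
move=> mE; split; first exact: integrable_indic.
by rewrite integral_indic// setIT fineK// fin_num_measure.
Qed.

Lemma has_mean_sum (I : Type) (s : seq I) (F : I -> T -> R) (c : I -> R) :
  (forall i, has_mean (F i) (c i)) ->
  has_mean (fun w => \sum_(i <- s) F i w) (\sum_(i <- s) c i).
Proof.
move=> Fc; elim: s => [|i s IHs].
  by rewrite big_nil; under eq_fun do rewrite big_nil; exact: has_mean_cst.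
by rewrite big_cons; under eq_fun do rewrite big_cons; exact: has_meanD.
Qed.

(** For a nonnegative function, finiteness of the integral already gives integrability. *)
Lemma ge0_has_mean f c : measurable_fun [set: T] f -> (forall w, 0 <= f w) ->
  (\int[P]_w (f w)%:E = c%:E)%E -> has_mean f c.
Proof.
move=> mf f0 fc; split => //; apply/integrableP; split.
  exact/measurable_EFinP.
under eq_integral do rewrite /= ger0_norm//.
by rewrite fc ltry.
Qed.

Lemma integrable_ae_eq f g : measurable_fun [set: T] g ->
  {ae P, forall w, f w = g w} ->
  P.-integrable [set: T] (EFin \o f) -> P.-integrable [set: T] (EFin \o g).
Proof.
move=> mg fg fi; have mf : measurable_fun [set: T] f.
  by move/measurable_int/measurable_EFinP: fi.
have [_ fy] := integrableP _ _ _ fi.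
apply/integrableP; split; first exact/measurable_EFinP.
rewrite (le_lt_trans _ fy)//.
rewrite (@ae_eq_integral _ _ _ P _ (abse \o (EFin \o f)))//.
- by apply: measurableT_comp => //; exact/measurable_EFinP.
- by apply: measurableT_comp => //; exact/measurable_EFinP.
- by apply: filterS fg => w /= ->.
Qed.

Lemma has_mean_ae_eq f g c : measurable_fun [set: T] g ->
  {ae P, forall w, f w = g w} -> has_mean f c -> has_mean g c.
Proof.
move=> mg fg fc; have mf := has_mean_measurable fc.
case: fc => fi fc; split; first exact: integrable_ae_eq fg fi.
rewrite -fc; apply: ae_eq_integral => //; try exact/measurable_EFinP.
by apply: filterS fg => w /= ->.
Qed.

Lemma le_integrable_EFin f g : measurable_fun [set: T] g ->
  (forall w, `|g w| <= `|f w|) ->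
  P.-integrable [set: T] (EFin \o f) -> P.-integrable [set: T] (EFin \o g).
Proof.
move=> mg fg; apply: le_integrable => //; first exact/measurable_EFinP.
by move=> w _; rewrite lee_fin.
Qed.

End means.

(** * Integrals weighted by a function of [Z] *)

Section weighted_integrals.
Context d (T : measurableType d) (R : realType) (P : probability T R).
Context d' (S : measurableType d') (Z : T -> S).
Context (mZ : measurable_fun [set: T] Z).

Import HBNNSimple.

Let wint (h : S -> R) (G : T -> R) := (\int[P]_w (h (Z w) * G w)%:E)%E.

(** A simple weight is the sum of its values times the indicators of its level sets, so only
    integrals of [G] over preimages under [Z] enter. *)
Let wint_nnsfun (h : {nnsfun S >-> R}) (G : T -> R) :
  measurable_fun [set: T] G -> (forall w, 0 <= G w) ->
  (wint h G = \sum_(y \in range h)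
    (y%:E * \int[P]_(w in Z @^-1` (h @^-1` [set y])) (G w)%:E))%E.
Proof.
move=> mG G0.
have mi y : measurable (Z @^-1` (h @^-1` [set y])).
  by rewrite -[X in measurable X]setTI; exact: mZ.
transitivity (\int[P]_w (\sum_(y \in range h)
   (y * (\1_(Z @^-1` (h @^-1` [set y])) w * G w))%:E))%E.
  apply: eq_integral => w _; rewrite fsumEFin//; congr EFin.
  rewrite {1}(fimfunE h (Z w)) mulr_fsuml//=.
  by apply: eq_fsbigr => y _; rewrite -mulrA; congr (_ * _).
rewrite ge0_integral_fsum//; last 2 first.
- move=> y; apply/measurable_EFinP/measurable_funM => //.
  exact: measurable_funM.
(* Nonnegativity of [y] is known only for values of [h]; for any [y] other than [h (Z w)] the
   indicator vanishes. *)
- move=> y w _; have [hy|hy] := pselect (h (Z w) = y).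
    by rewrite lee_fin -hy mulr_ge0// mulr_ge0.
  by rewrite indicE memNset// mul0r mulr0.
apply: eq_fsbigr => y; rewrite inE => -[s _ hs].
under eq_integral do rewrite EFinM.
rewrite ge0_integralZl//; last 3 first.
- by apply/measurable_EFinP; exact: measurable_funM.
- by move=> w _; rewrite lee_fin mulr_ge0.
- by rewrite -hs lee_fin.
congr (_ * _)%E; rewrite [RHS]integral_mkcond; apply: eq_integral => w _.
by rewrite patchE indicE; case: ifPn => _; rewrite ?mul1r ?mul0r.
Qed.

(** Simple functions increasing to [h] stay ordered after multiplication by [G >= 0], so monotone
    convergence applies. *)
Let wint_lim (h : S -> R) (G : T -> R)
    (mh : measurable_fun [set: S] (EFin \o h)) :
  (forall x, 0 <= h x) ->
  measurable_fun [set: T] G -> (forall w, 0 <= G w) ->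
  wint h G = limn (fun n => wint (nnsfun_approx measurableT mh n) G).
Proof.
move=> h0 mG G0; pose a := nnsfun_approx measurableT mh.
have maG n : measurable_fun [set: T] (fun w => (a n (Z w) * G w)%:E).
  apply/measurable_EFinP; apply: measurable_funM => //.
  exact: (measurableT_comp _ mZ).
rewrite /wint -(@monotone_convergence _ _ _ P _ measurableT
  (fun n w => (a n (Z w) * G w)%:E))//.
- apply: eq_integral => w _; apply/esym/cvg_lim => //.
  under eq_fun do rewrite EFinM.
  rewrite EFinM; apply: cvgeZr => //.
  apply: (@cvg_nnsfun_approx _ _ _ _ measurableT _ mh) => // x _.
  by rewrite lee_fin.
- by move=> n w _; rewrite lee_fin mulr_ge0.
- move=> w _ m n mn; rewrite lee_fin ler_wpM2r//.
  exact/lefP/nd_nnsfun_approx.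
Qed.

(** The set integrals settle simple weights, and monotone limits give the rest. Both sides may be
    infinite. *)
Lemma eq_weighted_integral (h : S -> R) (G Q : T -> R) :
  measurable_fun [set: S] h -> (forall x, 0 <= h x) ->
  measurable_fun [set: T] G -> (forall w, 0 <= G w) ->
  measurable_fun [set: T] Q -> (forall w, 0 <= Q w) ->
  (forall B, measurable B -> \int[P]_(w in Z @^-1` B) (G w)%:E =
                             \int[P]_(w in Z @^-1` B) (Q w)%:E)%E ->
  (\int[P]_w (h (Z w) * G w)%:E = \int[P]_w (h (Z w) * Q w)%:E)%E.
Proof.
move=> mh h0 mG G0 mQ Q0 GQ.
have meh : measurable_fun [set: S] (EFin \o h) by exact/measurable_EFinP.
rewrite -/(wint h G) -/(wint h Q) !(wint_lim meh)//.
congr (limn _); apply/funext => n; rewrite !wint_nnsfun//.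
by apply: eq_fsbigr => y _; rewrite GQ.
Qed.

End weighted_integrals.

(** * Conditional probabilities: uniqueness, bounds, weights and mean-zero residuals *)

Section conditional_probability.
Context d (T : measurableType d) (R : realType) (P : probability T R).
Context d' (S : measurableType d') (Z : T -> S).
Context (mZ : measurable_fun [set: T] Z).
Implicit Types (E : set T) (f g h : S -> R).

Let mZpre B : measurable B -> measurable (Z @^-1` B).
Proof. by move=> mB; rewrite -[X in measurable X]setTI; exact: mZ. Qed.

Let mcomp f : measurable_fun [set: S] f -> measurable_fun [set: T] (f \o Z).
Proof. by move=> mf; exact: measurableT_comp. Qed.

(** Test on the event [g < f]: the integral of [f - g] over it is both nonnegative and nonpositive,
    so [f - g] vanishes almost surely there and the event is null. *)
Lemma ae_le_set_integral f g :
  measurable_fun [set: S] f -> measurable_fun [set: S] g ->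
  P.-integrable [set: T] (fun w => (f (Z w))%:E) ->
  P.-integrable [set: T] (fun w => (g (Z w))%:E) ->
  (forall B, measurable B -> \int[P]_(w in Z @^-1` B) (f (Z w))%:E <=
                             \int[P]_(w in Z @^-1` B) (g (Z w))%:E)%E ->
  {ae P, forall w, f (Z w) <= g (Z w)}.
Proof.
move=> mf mg fi gi fg; pose B := [set x | g x < f x].
have mB : measurable B by apply: measurable_eq_true; exact: measurable_fun_ltr.
pose D := Z @^-1` B; have mD : measurable D by exact: mZpre.
have iS u : P.-integrable [set: T] u -> P.-integrable D u.
  by apply: integrableS.
pose k w := (f (Z w) - g (Z w))%:E.
have mk : measurable_fun D k.
  apply/measurable_EFinP; apply: measurable_funTS.
  by apply: measurable_funB; exact: mcomp.
have k0 : (\int[P]_(w in D) `|k w| = 0)%E.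
  rewrite (eq_integral k); last first.
    move=> w; rewrite inE => Dw; rewrite gee0_abs// lee_fin subr_ge0.
    exact: ltW.
  apply/eqP; rewrite eq_le; apply/andP; split; last first.
    by apply: integral_ge0 => w Dw; rewrite lee_fin subr_ge0; exact: ltW.
  rewrite /k; under eq_integral do rewrite EFinB.
  rewrite integralB//; [|exact: iS..].
  by rewrite sube_le0 ?fg//; apply: integrable_fin_num => //; exact: iS.
move/(ae_eq_integral_abs P mD mk): k0 => k0.
apply: filterS k0 => w kw; rewrite leNgt; apply/negP => fgw.
have := kw fgw => -[] /eqP; rewrite subr_eq0 => /eqP fgE.
by move: fgw; rewrite fgE ltxx.
Qed.

Lemma cond_prob_congr E f g : measurable_fun [set: S] g ->
  {ae P, forall w, f (Z w) = g (Z w)} ->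
  is_cond_prob P Z E f -> is_cond_prob P Z E g.
Proof.
move=> mg fg [mf fi fE]; split => //.
  exact: (integrable_ae_eq (mcomp mg) fg).
move=> B mB; rewrite -fE//; apply: ae_eq_integral => //.
- exact: mZpre.
- by apply/measurable_EFinP/measurable_funTS; exact: mcomp.
- by apply/measurable_EFinP/measurable_funTS; exact: mcomp.
- by apply: filterS fg => w -> .
Qed.

Lemma cond_prob_unique E f g :
  is_cond_prob P Z E f -> is_cond_prob P Z E g ->
  {ae P, forall w, f (Z w) = g (Z w)}.
Proof.
move=> [mf fi fE] [mg gi gE].
have fg : {ae P, forall w, f (Z w) <= g (Z w)}.
  by apply: ae_le_set_integral => // B mB; rewrite fE// gE.
have gf : {ae P, forall w, g (Z w) <= f (Z w)}.
  by apply: ae_le_set_integral => // B mB; rewrite fE// gE.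
by apply: filterS2 fg gf => w fg gf; apply/eqP; rewrite eq_le fg gf.
Qed.

(** Comparison with the constants [0] and [1] through [0 <= P(E, Z in B) <= P(Z in B)]. *)
Lemma cond_prob_itv01 E f : measurable E -> is_cond_prob P Z E f ->
  {ae P, forall w, 0 <= f (Z w) <= 1}.
Proof.
move=> mE [mf fi fE].
have f0 : {ae P, forall w, 0 <= f (Z w)}.
  apply: (@ae_le_set_integral (cst 0)) => //; first exact: integrable0.
  by move=> B mB; rewrite fE// integral0.
have f1 : {ae P, forall w, f (Z w) <= 1}.
  apply: (@ae_le_set_integral _ (cst 1)) => //.
    exact: finite_measure_integrable_cst.
  move=> B mB; have mZB := mZpre mB.
  rewrite fE// (eq_integral (cst 1%E))// integral_cst ?mul1e//.
  by apply: le_measure; rewrite ?inE//; exact: measurableI.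
by apply: filterS2 f0 f1 => w -> ->.
Qed.

Lemma cond_probC E f : measurable E -> is_cond_prob P Z E f ->
  is_cond_prob P Z (~` E) (fun x => 1 - f x).
Proof.
move=> mE [mf fi fE].
have i1 : P.-integrable [set: T] (EFin \o cst 1).
  exact: finite_measure_integrable_cst.
split; first exact: measurable_funB.
  by under eq_fun do rewrite EFinB; exact: integrableB.
move=> B mB; have mZB := mZpre mB.
under eq_integral do rewrite EFinB.
rewrite integralB//; [|exact: integrableS i1|exact: integrableS fi].
rewrite integral_cst// mul1e fE// [in RHS]setIC -setDE measureD// 1?setIC//.
by rewrite ltey_eq fin_num_measure.
Qed.

Lemma cond_prob_has_mean E f : measurable E -> is_cond_prob P Z E f ->
  has_mean P (fun w => f (Z w)) (fine (P E)).
Proof.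
move=> mE [mf fi fE]; split => //.
by rewrite -(preimage_setT Z) fE// setIT fineK// fin_num_measure.
Qed.

(** A version lies in [[0, 1]] only almost surely; truncation makes the bounds hold everywhere, as
    the lemmas on nonnegative integrands ask. *)
Definition clamp01 f x := Num.max 0 (Num.min 1 (f x)).

Lemma measurable_clamp01 f :
  measurable_fun [set: S] f -> measurable_fun [set: S] (clamp01 f).
Proof. by move=> mf; apply: measurable_maxr => //; exact: measurable_minr. Qed.

Lemma clamp01_itv f x : 0 <= clamp01 f x <= 1.
Proof. by rewrite /clamp01 le_max lexx/= ge_max ler01 ge_min lexx. Qed.

Lemma clamp01_ae E f : measurable E -> is_cond_prob P Z E f ->
  {ae P, forall w, f (Z w) = clamp01 f (Z w)}.
Proof.
move=> mE /(cond_prob_itv01 mE); apply: filterS => w /andP[f0 f1].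
by rewrite /clamp01 (min_idPr f1) (max_idPr f0).
Qed.

Lemma cond_prob_clamp01 E f : measurable E -> is_cond_prob P Z E f ->
  is_cond_prob P Z E (clamp01 f).
Proof.
move=> mE fE; apply: (cond_prob_congr _ (clamp01_ae mE fE)) => //.
by case: (fE) => mf _ _; exact: measurable_clamp01.
Qed.

(** Over each event [Z in B], [\1_E] and the truncation of [f] have the same integral, so a
    nonnegative weight in [Z] may be inserted; the common value may be infinite. *)
Lemma cond_prob_weighted_integral E f h : measurable E ->
  is_cond_prob P Z E f -> measurable_fun [set: S] h -> (forall x, 0 <= h x) ->
  (\int[P]_w (h (Z w) * \1_E w)%:E = \int[P]_w (h (Z w) * f (Z w))%:E)%E.
Proof.
move=> mE fE mh h0; have [mf _ _] := fE.
have [mf' fi' fE'] := cond_prob_clamp01 mE fE.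
rewrite [RHS](@ae_eq_integral _ _ _ P _
  (fun w => (h (Z w) * clamp01 f (Z w))%:E))//; last 3 first.
- by apply/measurable_EFinP/measurable_funM; exact: mcomp.
- by apply/measurable_EFinP/measurable_funM; exact: mcomp.
- by apply: filterS (clamp01_ae mE fE) => w <-.
apply: (@eq_weighted_integral _ _ _ P _ _ Z mZ h (\1_E)
  (fun w => clamp01 f (Z w))) => //.
- exact: mcomp.
- by move=> w; have /andP[] := clamp01_itv f (Z w).
move=> B mB; rewrite fE' ?integral_indic//; exact: mZpre.
Qed.

Lemma cond_prob_weighted_mean E f h c : measurable E ->
  is_cond_prob P Z E f -> measurable_fun [set: S] h -> (forall x, 0 <= h x) ->
  has_mean P (fun w => h (Z w) * f (Z w)) c ->
  has_mean P (fun w => h (Z w) * \1_E w) c.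
Proof.
move=> mE fE mh h0 [_ hfc]; apply: ge0_has_mean.
- by apply: measurable_funM; [exact: mcomp|].
- by move=> w; rewrite mulr_ge0.
- by rewrite (cond_prob_weighted_integral mE fE).
Qed.

(* With [0 <= f <= 1], the positive and negative parts of
   [h (Z w) * (\1_E w - f (Z w))] are [h (1 - f) \1_E] and [h f \1_(~` E)], whose
   means are both that of [h f (1 - f)]; no integrability of [h] is needed. *)
Let residual_mean0_ge0 E f h : measurable E -> is_cond_prob P Z E f ->
  (forall x, 0 <= f x <= 1) ->
  measurable_fun [set: S] h -> (forall x, 0 <= h x) ->
  P.-integrable [set: T] (fun w => (h (Z w) * (\1_E w - f (Z w)))%:E) ->
  has_mean P (fun w => h (Z w) * (\1_E w - f (Z w))) 0.
Proof.
move=> mE fE f01 mh h0 hi; have [mf _ _] := fE.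
have f0 x : 0 <= f x by have /andP[] := f01 x.
have f1 x : 0 <= 1 - f x by rewrite subr_ge0; have /andP[] := f01 x.
have m1f : measurable_fun [set: S] (fun x => 1 - f x) by exact: measurable_funB.
pose psi w := h (Z w) * (\1_E w - f (Z w)).
pose u w := h (Z w) * (1 - f (Z w)) * \1_E w.
pose v w := h (Z w) * f (Z w) * \1_(~` E) w.
have hE w : h (Z w) * (\1_E w - f (Z w)) = u w - v w.
  rewrite /u /v !indicE in_setC; case: (w \in E) => /=.
    by rewrite mulr0 subr0 mulr1.
  by rewrite mulr0 !sub0r mulr1 mulrN.
have mu : measurable_fun [set: T] u.
  apply: measurable_funM => //; apply: measurable_funM; first exact: mcomp.
  exact: (mcomp m1f).
have mv : measurable_fun [set: T] v.
  apply: measurable_funM; last by apply: measurable_indic; exact: measurableC.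
  by apply: measurable_funM; exact: mcomp.
have ui : P.-integrable [set: T] (EFin \o u).
  apply: (@le_integrable_EFin _ _ _ _ psi) => // w.
  rewrite /psi hE /u /v !indicE in_setC.
  by case: (w \in E); rewrite /= ?mulr0 ?mulr1 ?subr0// normr0.
have vi : P.-integrable [set: T] (EFin \o v).
  apply: (@le_integrable_EFin _ _ _ _ psi) => // w.
  rewrite /psi hE /u /v !indicE in_setC.
  by case: (w \in E); rewrite /= ?mulr0 ?mulr1 ?sub0r ?normrN// normr0.
have uv : (\int[P]_w (u w)%:E = \int[P]_w (v w)%:E)%E.
  rewrite (cond_prob_weighted_integral mE fE
    (h := fun x => h x * (1 - f x)))//; last 2 first.
  - exact: measurable_funM.
  - by move=> x; rewrite mulr_ge0.
  rewrite (cond_prob_weighted_integral (measurableC mE) (cond_probC mE fE)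
    (h := fun x => h x * f x))//; last 2 first.
  - exact: measurable_funM.
  - by move=> x; rewrite mulr_ge0.
  by apply: eq_integral => w _; rewrite mulrAC.
pose c := fine (\int[P]_w (u w)%:E)%E.
have cE : (\int[P]_w (u w)%:E = c%:E)%E by rewrite fineK// integrable_fin_num.
under eq_fun do rewrite hE.
by rewrite -(subrr c); apply: has_meanB; split=> //; rewrite -uv.
Qed.

(** Reduction to the nonnegative case: [f] is truncated to [[0, 1]] and [h] is split into positive
    and negative parts. Each part is at most [|h|], so its residual inherits integrability from that
    of [h]. *)
Lemma cond_prob_residual_mean0 E f h : measurable E -> is_cond_prob P Z E f ->
  measurable_fun [set: S] h ->
  P.-integrable [set: T] (fun w => (h (Z w) * (\1_E w - f (Z w)))%:E) ->
  has_mean P (fun w => h (Z w) * (\1_E w - f (Z w))) 0.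
Proof.
move=> mE fE mh hi; have [mf _ _] := fE.
have mE1 : measurable_fun [set: T] (\1_E : T -> R) by exact: measurable_indic.
have fE' := cond_prob_clamp01 mE fE; have [mf' _ _] := fE'.
pose k h w := h (Z w) * (\1_E w - clamp01 f (Z w)).
have mk g : measurable_fun [set: S] g -> measurable_fun [set: T] (k g).
  move=> mg; apply: measurable_funM; first exact: mcomp.
  by apply: measurable_funB => //; exact: mcomp.
have kh : {ae P, forall w, h (Z w) * (\1_E w - f (Z w)) = k h w}.
  by apply: filterS (clamp01_ae mE fE) => w fw; rewrite /k -fw.
have ki : P.-integrable [set: T] (EFin \o k h).
  by apply: integrable_ae_eq kh hi; exact: mk.
have part g : measurable_fun [set: S] g -> (forall x, 0 <= g x <= `|h x|) ->
    has_mean P (k g) 0.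
  move=> mg gh; apply: residual_mean0_ge0 => //.
  - exact: clamp01_itv.
  - by move=> x; have /andP[] := gh x.
  apply: (@le_integrable_EFin _ _ _ _ (k h)) => // [|w]; first exact: mk.
  rewrite /k !normrM ler_wpM2r//; have /andP[g0 ?] := gh (Z w).
  by rewrite ger0_norm.
apply: (@has_mean_ae_eq _ _ _ _ (k h)).
- apply: measurable_funM; first exact: mcomp.
  by apply: measurable_funB => //; exact: mcomp.
- by apply: filterS kh => w ->.
have khE : k h = fun w => k h^\+ w - k h^\- w.
  by apply/funext => w; rewrite /k -mulrBl -{1}(funrposBneg h).
suff: has_mean P (fun w => k h^\+ w - k h^\- w) (0 - 0) by rewrite subr0 khE.
apply: has_meanB; apply: part.
- exact: measurable_funrpos.
- by move=> x; rewrite /funrpos le_max lexx orbT ge_max ler_norm normr_ge0.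
- exact: measurable_funrneg.
- move=> x; rewrite /funrneg le_max lexx orbT ge_max normr_ge0 andbT.
  by rewrite -normrN ler_norm.
Qed.

(** [cond_indep] only provides some pair of versions; almost sure uniqueness passes the product
    formula on to the given [f] and [g]. *)
Lemma cond_indep_prob d1 (S1 : measurableType d1) (U : T -> S1)
    d2 (S2 : measurableType d2) (V : T -> S2) (B : set S1) (C : set S2) f g :
  measurable B -> measurable C -> cond_indep P Z U V ->
  is_cond_prob P Z (U @^-1` B) f -> is_cond_prob P Z (V @^-1` C) g ->
  is_cond_prob P Z (U @^-1` B `&` V @^-1` C) (fun x => f x * g x).
Proof.
move=> mB mC /(_ B C mB mC)[f' [g' [f'B g'C f'g']]] fB gC.
apply: cond_prob_congr f'g'.
  by case: fB gC => mf _ _ [mg _ _]; exact: measurable_funM.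
have := cond_prob_unique g'C gC; have := cond_prob_unique f'B fB.
by apply: filterS2 => w -> ->.
Qed.

End conditional_probability.

(** * Conditioning on [Z] together with a Boolean variable *)

Section conditional_probability_given_pair.
Context d (T : measurableType d) (R : realType) (P : probability T R).
Context d' (S : measurableType d') (Z : T -> S).
Context (mZ : measurable_fun [set: T] Z).

Let mZpre B : measurable B -> measurable (Z @^-1` B).
Proof. by move=> mB; rewrite -[X in measurable X]setTI; exact: mZ. Qed.

Let mem_preimage w B : (w \in Z @^-1` B) = (Z w \in B).
Proof. by []. Qed.

(** The integral of [e (Z w)] over the event [N (Z w)] is the probability of that event within [E],
    which is zero; as [e > 0], the event itself is null. This carries facts known on the treated
    over to the whole population. *)
Lemma cond_prob_gt0_ae (E : set T) (e : S -> R) (N : set S) :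
  measurable E -> measurable N ->
  is_cond_prob P Z E e -> (forall x, 0 < e x) ->
  {ae P, forall w, E w -> ~ N (Z w)} -> {ae P, forall w, ~ N (Z w)}.
Proof.
move=> mE mN [me ei eE] e0 EN.
have mZN : measurable (Z @^-1` N) by exact: mZpre.
have PEN : P (E `&` Z @^-1` N) = 0%E.
  apply: measure_negligible; first exact: measurableI.
  by apply: negligibleS EN => w [Ew Nw] /(_ Ew).
have k0 : (\int[P]_(w in Z @^-1` N) `|(e (Z w))%:E| = 0)%E.
  rewrite -PEN -eE//; apply: eq_integral => w _.
  by rewrite gee0_abs// lee_fin ltW.
have mk : measurable_fun (Z @^-1` N) (fun w => (e (Z w))%:E).
  by apply/measurable_EFinP/measurable_funTS; exact: measurableT_comp.
move/(ae_eq_integral_abs P mZN mk): k0; apply: filterS => w kw Nw.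
by have /eqP := kw Nw; rewrite eqe gt_eqF.
Qed.

Lemma cond_prob_restrict (E : set T) (g : S -> R) (B : set S) :
  measurable B -> is_cond_prob P Z E g ->
  is_cond_prob P Z (E `&` Z @^-1` B) (fun x => \1_B x * g x).
Proof.
move=> mB [mg gi gE].
have m1 : measurable_fun [set: S] (fun x => \1_B x * g x).
  exact: measurable_funM.
split => //.
  apply: (@le_integrable_EFin _ _ _ _ (fun w => g (Z w))) => // [|w].
    exact: (measurableT_comp m1).
  by rewrite indicE; case: (Z w \in B); rewrite ?mul1r// mul0r normr0.
move=> C mC; rewrite -setIA -preimage_setI -gE; last exact: measurableI.
rewrite [LHS]integral_mkcond [RHS]integral_mkcond; apply: eq_integral => w _.
rewrite !patchE indicE preimage_setI in_setI !mem_preimage.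
by case: (Z w \in B); case: (Z w \in C); rewrite ?mul1r ?mul0r.
Qed.

(** The hypothesis on [f x * e x] expresses conditional independence of [E] and [V] given [Z], so
    learning [V] does not change the probability of [E]. On [V = true] an event [B] of pairs reduces
    to its slice [B1], and both sides become the integral of [f * e] over [B1]. *)
Lemma cond_prob_pair (V : T -> bool) (E : set T) (f e : S -> R) :
  measurable_fun [set: T] V -> measurable E -> (forall x, 0 <= f x <= 1) ->
  is_cond_prob P Z [set w | V w = true] e -> is_cond_prob P Z E f ->
  is_cond_prob P Z (E `&` [set w | V w = true]) (fun x => f x * e x) ->
  is_cond_prob P (fun w => (Z w, V w)) (E `&` [set w | V w = true])
    (fun xv => xv.2%:R * f xv.1).
Proof.
move=> mV mE f01 eV [mf fi _] [_ _ feE].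
have mVt := measurable_eq_true mV.
have mnat : measurable_fun [set: bool] (fun b => b%:R : R) by [].
have m2 : measurable_fun [set: S * bool] (fun xv => xv.2%:R * f xv.1).
  apply: measurable_funM; first exact: (measurableT_comp mnat).
  exact: measurableT_comp.
split => //.
  apply: (@le_integrable_EFin _ _ _ _ (fun w => f (Z w))) => // [|w /=].
    by apply: (measurableT_comp m2); exact: measurable_fun_pair.
  by case: (V w); rewrite ?mul1r// mul0r normr0.
move=> B mB; pose B1 := [set x | B (x, true)].
have mB1 : measurable B1.
  have mp : measurable_fun [set: S] (fun x : S => (x, true)).
    by apply: measurable_fun_pair.
  by rewrite -[B1]setTI; exact: mp.
have -> : (E `&` [set w | V w = true] `&` (fun w => (Z w, V w)) @^-1` B) =
    (E `&` [set w | V w = true] `&` Z @^-1` B1).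
  by apply/seteqP; split=> w /= [[Ew Vw]]; rewrite /B1 Vw.
rewrite -feE//.
transitivity (\int[P]_w
  (\1_B1 (Z w) * f (Z w) * \1_[set w | V w = true] w)%:E)%E.
  rewrite [LHS]integral_mkcond; apply: eq_integral => w _.
  rewrite patchE indic_eq_true [\1_B1 _]indicE /=.
  case Vw : (V w); last by rewrite mulr0 mul0r; case: ifP.
  have -> : (w \in (fun w => (Z w, V w)) @^-1` B) = (Z w \in B1).
    by apply/idP/idP; rewrite !inE /B1 /= Vw.
  by rewrite mulr1 mul1r; case: (_ \in _); rewrite ?mul1r// mul0r.
rewrite (cond_prob_weighted_integral mZ mVt eV
  (h := fun x => \1_B1 x * f x)) //.
- rewrite [RHS]integral_mkcond; apply: eq_integral => w _.
  rewrite patchE indicE mem_preimage.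
  by case: (_ \in _); rewrite ?mul1r// !mul0r.
- exact: measurable_funM.
- by move=> x; rewrite mulr_ge0//; have /andP[] := f01 x.
Qed.

End conditional_probability_given_pair.

(** * Identification of the means of the limiting summands *)

Section identification.
Context d (T : measurableType d) (R : realType) (P : probability T R).
Context d' (S : measurableType d') (X : T -> S) (A Y Y0 Y1 : T -> bool).
Context (mX : measurable_fun [set: T] X) (mA : measurable_fun [set: T] A)
  (mY : measurable_fun [set: T] Y) (mY0 : measurable_fun [set: T] Y0)
  (mY1 : measurable_fun [set: T] Y1).
Context (e : S -> R) (mu : bool -> S -> R).
Context (consistency : forall w, Y w = if A w then Y1 w else Y0 w)
  (e_propensity : is_cond_prob P X [set w | A w = true] e)
  (mu_regression : is_cond_prob P (fun w => (X w, A w)) [set w | Y w = true]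
     (fun xa => mu xa.2 xa.1))
  (ignorability : cond_indep P X (fun w => (Y0 w, Y1 w)) A)
  (overlap : forall x, 0 < e x < 1).

Let mXA : measurable_fun [set: T] (fun w => (X w, A w)).
Proof. exact: measurable_fun_pair. Qed.

Let me : measurable_fun [set: S] e.
Proof. by case: e_propensity. Qed.

Let mmu a : measurable_fun [set: S] (mu a).
Proof.
case: mu_regression => mf _ _.
have mp : measurable_fun [set: S] (fun x : S => (x, a)).
  by apply: measurable_fun_pair.
exact: (measurableT_comp mf mp).
Qed.

Let mnat : measurable_fun [set: bool] (fun b => b%:R : R).
Proof. by []. Qed.

Let mcomp (f : S -> R) : measurable_fun [set: S] f ->
  measurable_fun [set: T] (fun w => f (X w)).
Proof. by move=> mf; exact: measurableT_comp. Qed.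

Let treated_Y1 : [set w | Y w = true] `&` [set w | A w = true] =
  [set w | Y1 w = true] `&` [set w | A w = true].
Proof.
by apply/seteqP; split=> w /= []; rewrite consistency => + Aw; rewrite Aw.
Qed.

Definition untreated w := ~~ A w.

Let untreated_propensity :
  is_cond_prob P X [set w | untreated w = true] (fun x => 1 - e x).
Proof.
rewrite (_ : [set w | untreated w = true] = ~` [set w | A w = true]).
  exact: (cond_probC mX (measurable_eq_true mA)).
by apply/seteqP; split=> w /=; rewrite /untreated; case: (A w).
Qed.

(** Taking the whole space as the event for [A] in ignorability yields a version for any event on
    [(Y0, Y1)]; truncation then gives the bounds. *)
Lemma potential_outcome_version (g : bool * bool -> bool) :
  exists2 f : S -> R, is_cond_prob P X [set w | g (Y0 w, Y1 w) = true] f &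
    forall x, 0 <= f x <= 1.
Proof.
have mb : measurable_fun [set: T] (fun w => g (Y0 w, Y1 w)).
  apply: (measurableT_comp (@measurable_fun_bool2 g)).
  exact: measurable_fun_pair.
have mg := measurable_eq_true (@measurable_fun_bool2 g).
have [f [_ [fb _ _]]] := ignorability mg measurableT.
exists (clamp01 f); last exact: clamp01_itv.
by apply: cond_prob_clamp01 => //; exact: measurable_eq_true.
Qed.

Lemma potential_outcome_treated (g : bool * bool -> bool) (f : S -> R) :
  is_cond_prob P X [set w | g (Y0 w, Y1 w) = true] f ->
  is_cond_prob P X
    ([set w | g (Y0 w, Y1 w) = true] `&` [set w | A w = true])
    (fun x => f x * e x).
Proof.
move=> fg; have mg := measurable_eq_true (@measurable_fun_bool2 g).
exact: (cond_indep_prob mX mg (C := [set true]) _ ignorability).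
Qed.

Lemma potential_outcome_untreated (g : bool * bool -> bool) (f : S -> R) :
  is_cond_prob P X [set w | g (Y0 w, Y1 w) = true] f ->
  is_cond_prob P X
    ([set w | g (Y0 w, Y1 w) = true] `&` [set w | untreated w = true])
    (fun x => f x * (1 - e x)).
Proof.
move=> fg; have untreatedE : [set w | untreated w = true] = A @^-1` [set false].
  by apply/seteqP; split=> w /=; rewrite /untreated; case: (A w).
have := untreated_propensity; rewrite untreatedE => untreated_e.
have mg := measurable_eq_true (@measurable_fun_bool2 g).
exact: (cond_indep_prob mX mg (C := [set false]) _ ignorability).
Qed.

(** Restricted to the treated, the regression and, by ignorability, [f] are versions of the same
    conditional probability given [(X, A)], hence agree there almost surely. Overlap then removes
    the restriction to the treated. *)
Lemma regression_treated (f : S -> R) : (forall x, 0 <= f x <= 1) ->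
  is_cond_prob P X [set w | Y1 w = true] f ->
  {ae P, forall w, mu true (X w) = f (X w)}.
Proof.
move=> f01 fY1; have [mf _ _] := fY1.
have mN : measurable [set x | mu true x != f x].
  apply: measurable_eq_true.
  exact: measurable_neg (measurable_fun_eqr (mmu true) mf).
have v1 := cond_prob_pair mX mA (measurable_eq_true mY1) f01 e_propensity fY1
  (@potential_outcome_treated snd f fY1).
have mB : measurable [set xa : S * bool | xa.2 = true].
  by apply: measurable_eq_true; exact: measurable_snd.
have v2 := cond_prob_restrict mXA mB mu_regression.
have : {ae P, forall w, A w = true -> ~ [set x | mu true x != f x] (X w)}.
  move: v2; rewrite treated_Y1 => /(cond_prob_unique mXA v1).
  apply: filterS => w + Aw; rewrite /= indic_eq_true /= Aw !mul1r => ->.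
  by rewrite eqxx.
have e0 x : 0 < e x by have /andP[] := overlap x.
move/(cond_prob_gt0_ae mX (measurable_eq_true mA) mN e_propensity e0).
by apply: filterS => w /negP; rewrite negbK => /eqP.
Qed.

(* Reweighting by the odds [(1 - e) / e] moves the treated law of [Y^1] to the
   untreated one. *)
Lemma odds_weighted_mean :
  has_mean P (fun w => (1 - e (X w)) / e (X w) *
    \1_([set w | Y1 w = true] `&` [set w | A w = true]) w)
  (fine (P ([set w | Y1 w = true] `&` [set w | untreated w = true]))).
Proof.
have [f fY1 f01] := potential_outcome_version snd.
have mw : measurable_fun [set: S] (fun x => (1 - e x) / e x).
  apply: measurable_funM; first exact: measurable_funB.
  exact: (measurableT_comp (@inv_measurable R setT)).
have mE b : measurable_fun [set: T] b ->
    measurable ([set w | Y1 w = true] `&` [set w | b w = true]).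
  by move=> mb; apply: measurableI; exact: measurable_eq_true.
apply: (cond_prob_weighted_mean mX (mE A mA)
  (@potential_outcome_treated snd f fY1) mw).
  move=> x; have /andP[? /ltW ?] := overlap x.
  by rewrite divr_ge0 ?subr_ge0// ltW.
have munt : measurable_fun [set: T] untreated by exact: measurable_neg.
have := cond_prob_has_mean (mE untreated munt)
  (@potential_outcome_untreated snd f fY1).
rewrite (_ : (fun w => f (X w) * _) = (fun w =>
  (1 - e (X w)) / e (X w) * (f (X w) * e (X w))))//.
apply/funext => w; have /andP[e0 _] := overlap (X w).
by field; rewrite gt_eqF.
Qed.

Let setI_true (b c : T -> bool) :
  [set w | b w = true] `&` [set w | c w = true] = [set w | b w && c w = true].
Proof. by apply/seteqP; split=> w /= => [[-> ->]//|/andP[-> ->]]. Qed.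

Let munt : measurable_fun [set: T] untreated.
Proof. exact: measurable_neg. Qed.

Definition untreated_pr (b : T -> bool) : R :=
  fine (P [set w | b w && untreated w = true]).

Let untreated_mean (b : T -> bool) : measurable_fun [set: T] b ->
  has_mean P (fun w => (b w && untreated w)%:R) (untreated_pr b).
Proof.
move=> mb.
have := has_mean_indic P (measurable_eq_true (measurable_and mb munt)).
by congr (has_mean P _ _); apply/funext => w; rewrite indic_eq_true.
Qed.

(** Weighting the untreated version [f0 (1 - e)] by [f1] gives [f0 f1 (1 - e)], a version for the
    joint event, and [mu true] replaces [f1] almost surely. The factorization hypothesis is trivial
    when [g0] is constantly true, and follows from conditional independence of [Y0] and [Y1] when
    [g0] is [negb]. *)
Let regression_weighted_mean (g0 : bool -> bool) (f0 f1 : S -> R) :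
  (forall x, 0 <= f1 x <= 1) -> is_cond_prob P X [set w | Y1 w = true] f1 ->
  is_cond_prob P X [set w | g0 (Y0 w) = true] f0 ->
  is_cond_prob P X [set w | g0 (Y0 w) && Y1 w = true] (fun x => f0 x * f1 x) ->
  has_mean P (fun w => mu true (X w) * (g0 (Y0 w) && untreated w)%:R)
    (untreated_pr (fun w => g0 (Y0 w) && Y1 w)).
Proof.
move=> f1_01 fY1 fY0 fY01; have [mf1 _ _] := fY1.
have mg0 : measurable_fun [set: T] (fun w => g0 (Y0 w)).
  by apply: (measurableT_comp (_ : measurable_fun [set: bool] g0)).
have v1 := @potential_outcome_untreated (fun z => g0 z.1) f0 fY0.
have v2 := @potential_outcome_untreated (fun z => g0 z.1 && z.2) _ fY01.
rewrite /= setI_true in v1; rewrite /= setI_true in v2.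
have mE : measurable [set w | g0 (Y0 w) && untreated w = true].
  by apply: measurable_eq_true; exact: measurable_and.
have : has_mean P
    (fun w => f1 (X w) * \1_[set w | g0 (Y0 w) && untreated w = true] w)
    (untreated_pr (fun w => g0 (Y0 w) && Y1 w)).
  apply: (cond_prob_weighted_mean mX mE v1 mf1).
    by move=> x; have /andP[] := f1_01 x.
  have mE2 : measurable [set w | (g0 (Y0 w) && Y1 w) && untreated w = true].
    apply: measurable_eq_true; apply: measurable_and => //.
    exact: measurable_and.
  have := cond_prob_has_mean mE2 v2; congr (has_mean P _ _).
  by apply/funext => w; rewrite mulrA [f1 _ * _]mulrC.
apply: has_mean_ae_eq.
  apply: measurable_funM; first exact: mcomp.
  by apply: (measurableT_comp mnat); exact: measurable_and.
apply: filterS (regression_treated f1_01 fY1) => w ->.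
by rewrite indic_eq_true.
Qed.

(** The correction equals [- phi] on the treated and vanishes on the untreated, so [|phi|] dominates
    it and its integrability comes from that of the whole summand. *)
Let residual_mean0 (h : S * bool -> R) (phi : T -> R) :
  measurable_fun [set: S * bool] h ->
  P.-integrable [set: T] (EFin \o phi) ->
  (forall w, h (X w, A w) * ((Y w)%:R - mu (A w) (X w)) =
    - phi w * (A w)%:R) ->
  has_mean P (fun w => h (X w, A w) * ((Y w)%:R - mu (A w) (X w))) 0.
Proof.
move=> mh phii phiE.
have mphi : measurable_fun [set: T] phi.
  by move/measurable_int/measurable_EFinP: phii.
under eq_fun => w do rewrite -(indic_eq_true R Y w).
apply: (cond_prob_residual_mean0 mXA (measurable_eq_true mY) mu_regression mh).
under eq_fun => w do rewrite indic_eq_true phiE.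
apply: (@le_integrable_EFin _ _ _ _ phi) => //.
  apply: measurable_funM; first exact: measurableT_comp.
  exact: (measurableT_comp mnat).
by move=> w; case: (A w); rewrite ?mulr1 ?mulr0 ?normrN ?normr0.
Qed.

Let modd (ebar : S -> R) : measurable_fun [set: S] ebar ->
  measurable_fun [set: S * bool]
    (fun xa => xa.2%:R / ebar xa.1 * (1 - ebar xa.1)).
Proof.
move=> mebar.
have mebar1 : measurable_fun [set: S * bool] (fun xa => ebar xa.1).
  exact: (measurableT_comp mebar).
apply: measurable_funM; last exact: measurable_funB.
apply: measurable_funM; first exact: (measurableT_comp mnat).
exact: (measurableT_comp (@inv_measurable R setT)).
Qed.

Lemma mono_mean_propensity (m1 : S -> R) :
  measurable_fun [set: S] m1 ->
  let phi w := mono_summand (e (X w)) (m1 (X w)) (A w) (Y w) in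
  P.-integrable [set: T] (EFin \o phi) ->
  has_mean P phi (untreated_pr Y0 - untreated_pr Y1).
Proof.
move=> mm1 phi phii.
have phi_mean : has_mean P phi (fine (\int[P]_w (phi w)%:E)%E).
  by split=> //; rewrite fineK// integrable_fin_num.
have mean1 := untreated_mean mY0.
have mean2 := odds_weighted_mean.
rewrite !setI_true -/(untreated_pr Y1) in mean2.
(* All terms in [m1] collect here, since [A (1 - e) / e + A - 1 = (A - e) / e]. *)
pose r w := m1 (X w) / e (X w) * (\1_[set w | A w = true] w - e (X w)).
have phiE w : phi w = (Y0 w && untreated w)%:R - (1 - e (X w)) / e (X w) *
    \1_[set w | Y1 w && A w = true] w + r w.
  have /andP[/gt_eqF e0 _] := overlap (X w).
  rewrite /r /phi /mono_summand !indic_eq_true consistency /untreated.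
  by case: (A w); case: (Y0 w); case: (Y1 w) => /=; field; rewrite e0.
(* [m1] itself carries no integrability; that of [r] comes from subtracting the two other terms from
   [phi]. *)
have ri : P.-integrable [set: T] (EFin \o r).
  have [] := has_meanB phi_mean (has_meanB mean1 mean2).
  by under eq_fun do rewrite phiE addrC addKr.
have r0 : has_mean P r 0.
  apply: (cond_prob_residual_mean0 mX (measurable_eq_true mA) e_propensity
    (h := fun x => m1 x / e x)) => //.
  apply: measurable_funM => //.
  exact: (measurableT_comp (@inv_measurable R setT)).
have := has_meanD (has_meanB mean1 mean2) r0.
by rewrite addr0; under eq_fun do rewrite -phiE.
Qed.

Lemma mono_mean_outcome (ebar : S -> R) :
  measurable_fun [set: S] ebar ->
  let phi w := mono_summand (ebar (X w)) (mu true (X w)) (A w) (Y w) in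
  P.-integrable [set: T] (EFin \o phi) ->
  has_mean P phi (untreated_pr Y0 - untreated_pr Y1).
Proof.
move=> mebar phi phii.
have mean1 := untreated_mean mY0.
have [f1 fY1 f01] := potential_outcome_version snd.
(* The sure event serves as the condition on [Y0], with version [1], so that the mean of [mu true]
   over the untreated becomes [P(Y1 = 1, A = 0)]. *)
have f1_true : is_cond_prob P X [set w | true = true] (fun=> 1 : R).
  split => //; first exact: finite_measure_integrable_cst.
  move=> B mB; have mXB : measurable (X @^-1` B).
    by rewrite -[X in measurable X]setTI; exact: mX.
  rewrite integral_cst// mul1e; congr (P _).
  by apply/seteqP; split=> w //= [].
have fY11 : is_cond_prob P X [set w | true && Y1 w = true]
    (fun x => 1 * f1 x).
  by rewrite (_ : (fun x => 1 * f1 x) = f1)//; apply/funext => x; rewrite mul1r.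
have mean2 := @regression_weighted_mean (fun=> true) _ _ f01 fY1 f1_true fY11.
have r0 := residual_mean0 (modd mebar) phii.
(* On the treated only the correction survives, the two other terms having the factor [1 - A] up to
   sign. *)
have hphi w : (A w)%:R / ebar (X w) * (1 - ebar (X w)) *
    ((Y w)%:R - mu (A w) (X w)) = - phi w * (A w)%:R.
  rewrite /phi /mono_summand; case: (A w) => /=; last by rewrite mulr0 !mul0r.
  by ring.
have := has_meanB (has_meanB mean1 mean2) (r0 hphi).
rewrite subr0 /=; congr (has_mean P _ _); apply/funext => w.
rewrite /phi /mono_summand /untreated consistency; case: (A w) => /=.
  by rewrite !andbF /=; ring.
by rewrite andbT; ring.
Qed.

Lemma inde_mean_outcome (ebar m0 : S -> R) :
  cond_indep P X Y0 Y1 ->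
  measurable_fun [set: S] ebar -> measurable_fun [set: S] m0 ->
  let phi w :=
    inde_summand (ebar (X w)) (m0 (X w)) (mu true (X w)) (A w) (Y w) in
  P.-integrable [set: T] (EFin \o phi) ->
  has_mean P phi (- untreated_pr (fun w => ~~ Y0 w && Y1 w)).
Proof.
move=> Y01 mebar mm0 phi phii.
have [f1 fY1 f01] := potential_outcome_version snd.
have [f0 fY0 _] := potential_outcome_version (fun z => ~~ z.1).
(* Conditional independence enters here: [P(Y0 = 0, Y1 = 1 | X)] factors as
   [regression_weighted_mean] asks. *)
have fY01 : is_cond_prob P X [set w | ~~ Y0 w && Y1 w = true]
    (fun x => f0 x * f1 x).
  have negE : [set w | ~~ Y0 w = true] = Y0 @^-1` [set false].
    by apply/seteqP; split=> w /=; case: (Y0 w).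
  rewrite -setI_true negE; rewrite /= negE in fY0.
  exact: (cond_indep_prob mX (B := [set false]) (C := [set true]) _ _ Y01).
have mean2 := @regression_weighted_mean negb _ _ f01 fY1 fY0 fY01.
(* The factor [1 - m0] depends on [X] alone, so it joins the weight of the residual. *)
have mh : measurable_fun [set: S * bool]
    (fun xa => xa.2%:R / ebar xa.1 * (1 - ebar xa.1) * (1 - m0 xa.1)).
  apply: measurable_funM; first exact: modd.
  by apply: measurable_funB => //; exact: measurableT_comp.
have r0 := residual_mean0 mh phii.
have hphi w : (A w)%:R / ebar (X w) * (1 - ebar (X w)) * (1 - m0 (X w)) *
    ((Y w)%:R - mu (A w) (X w)) = - phi w * (A w)%:R.
  rewrite /phi /inde_summand; case: (A w) => /=; last by rewrite mulr0 !mul0r.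
  by ring.
have := has_meanZ (-1) (has_meanD mean2 (r0 hphi)).
rewrite addr0 mulN1r /=; congr (has_mean P _ _); apply/funext => w.
rewrite /phi /inde_summand /untreated consistency; case: (A w) => /=.
  by rewrite !andbF /=; ring.
by rewrite andbT; case: (Y0 w) => /=; ring.
Qed.

(** When [Y0 <= Y1], the difference [Y0 - Y1] is minus the indicator of [Y0 = 0, Y1 = 1]; the means
    over the untreated follow. *)
Lemma untreated_pr_monotone : {ae P, forall w, (Y0 w <= Y1 w)%N} ->
  untreated_pr Y0 - untreated_pr Y1 =
    - untreated_pr (fun w => ~~ Y0 w && Y1 w).
Proof.
move=> le01; have m01 : measurable_fun [set: T] (fun w => ~~ Y0 w && Y1 w).
  by apply: measurable_and => //; exact: measurable_neg.
have mean1 := has_meanB (untreated_mean mY0) (untreated_mean mY1).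
have mean2 := has_meanZ (-1) (untreated_mean m01).
apply: (has_mean_unique mean1); rewrite -mulN1r; apply: has_mean_ae_eq mean2.
  exact: has_mean_measurable mean1.
apply: filterS le01 => w; rewrite /untreated.
by case: (A w); case: (Y0 w); case: (Y1 w) => //= _; ring.
Qed.

End identification.

(** * Convergence in probability: quotients and the weak law *)

Section convergence_in_probability.
Context d (T : measurableType d) (R : realType) (P : probability T R).

Lemma has_mean_le (f g : T -> R) (c c' : R) : (forall w, f w <= g w) ->
  has_mean P f c -> has_mean P g c' -> c <= c'.
Proof.
move=> fg [fi fc] [gi gc]; rewrite -lee_fin -fc -gc.
by apply: le_integral => // w _; rewrite lee_fin.
Qed.

Let mdev (V : T -> R) (c eps : R) : measurable_fun [set: T] V ->
  measurable [set w | eps < `|V w - c|].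
Proof.
move=> mV; apply: measurable_eq_true; apply: measurable_fun_ltr => //.
by apply: measurableT_comp => //; exact: measurable_funB.
Qed.

(** On the deviation event [(V - c) ^+ 2] is at least [eps ^+ 2], and elsewhere it is nonnegative;
    taking means gives Chebyshev's inequality. *)
Lemma chebyshev_has_mean (V : T -> R) (c v eps : R) : 0 < eps ->
  measurable_fun [set: T] V -> has_mean P (fun w => (V w - c) ^+ 2) v ->
  (P [set w | eps < `|V w - c|]%R <= (v / eps ^+ 2)%:E)%E.
Proof.
move=> eps0 mV Vv; have mB := mdev c eps mV.
have ind := has_meanZ (eps ^+ 2) (has_mean_indic P mB).
rewrite -[leLHS]fineK ?fin_num_measure// lee_fin ler_pdivlMr ?exprn_gt0//.
rewrite mulrC; apply: has_mean_le ind Vv => w.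
rewrite indicE; case: (boolP (w \in _)) => [|_]; last by rewrite mulr0 sqr_ge0.
rewrite inE /= => /ltW epsV; rewrite mulr1 -(real_normK (num_real (V w - c))).
by rewrite lerXn2r// nnegrE ltW.
Qed.

(** Division is continuous at [(a, b)] as [b != 0], so a large deviation of the quotient forces one
    of [V] or of [W]; a union bound finishes. *)
Lemma cvg_in_prob_div (V W : nat -> T -> R) (a b : R) : b != 0 ->
  (forall n, measurable_fun [set: T] (V n)) ->
  (forall n, measurable_fun [set: T] (W n)) ->
  cvg_in_prob P V a -> cvg_in_prob P W b ->
  cvg_in_prob P (fun n w => V n w / W n w) (a / b).
Proof.
move=> b0 mV mW Va Wb eps eps0.
have mVW n : measurable_fun [set: T] (fun w => V n w / W n w).
  apply: measurable_funM => //.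
  exact: (measurableT_comp (@inv_measurable R setT)).
have : (fun z : R * R => z.1 / z.2) z @[z --> (a, b)] --> a / b.
  by apply: cvgM; [exact: cvg_fst|apply: cvgV => //; exact: cvg_snd].
move=> /cvgrPdist_le /(_ eps eps0) /nbhs_ballP[del /= del0 delP].
have del20 : 0 < del / 2 by rewrite divr_gt0.
have del2 : del / 2 < del by rewrite gtr_pMr// invf_lt1// ltr1n.
apply: (@squeeze_cvge _ _ _ _ (cst 0%E) _ (fun n =>
  P [set w | del / 2 < `|V n w - a|]%R +
  P [set w | del / 2 < `|W n w - b|]%R)%E).
- apply: nearW => n; rewrite measure_ge0/=.
  apply: (le_trans _ (measureU2 _ (mdev _ _ (mV n)) (mdev _ _ (mW n)))).
  apply: le_measure; rewrite ?inE.
  + exact: (mdev _ _ (mVW n)).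
  + by apply: measurableU; exact: mdev.
  move=> w /= epsw; apply/orP; apply: contraTT epsw.
  rewrite negb_or -!leNgt => /andP[Vd Wd].
  rewrite distrC; apply: (delP (V n w, W n w)); split => /=.
    by rewrite -ball_normE /= distrC (le_lt_trans Vd).
  by rewrite -ball_normE /= distrC (le_lt_trans Wd).
- exact: cvg_cst.
- rewrite -[0%E in X in _ --> X]adde0.
  by apply: cvgeD => //; [exact: Va|exact: Wb].
Qed.

(** By pairwise independence the variance of the mean of [n] indicators is [(q - q ^+ 2) / n], so
    Chebyshev's bound tends to zero. *)
Lemma weak_law_indic d' (S : measurableType d') (D : nat -> T -> S) (Z : T -> S)
    (C : set S) :
  (forall i, measurable_fun [set: T] (D i)) -> iid_copies P D Z ->
  measurable C ->
  cvg_in_prob P (fun n w => sample_mean (fun i : 'I_n => \1_C (D i w)))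
    (fine (P (Z @^-1` C))).
Proof.
move=> mD [Dindep Did] mC eps eps0; set q := fine _.
have mE i : measurable (D i @^-1` C).
  by rewrite -[X in measurable X]setTI; exact: mD.
have qE i : fine (P (D i @^-1` C)) = q by rewrite Did.
have mean1 i : has_mean P (\1_(D i @^-1` C)) q.
  by rewrite -(qE i); exact: has_mean_indic.
have mean2 i j : has_mean P (fun w => \1_(D i @^-1` C) w * \1_(D j @^-1` C) w)
    (if i == j then q else q * q).
  have := has_mean_indic P (measurableI _ _ (mE i) (mE j)).
  rewrite (_ : \1_(_ `&` _) = fun w =>
    \1_(D i @^-1` C) w * \1_(D j @^-1` C) w :> R); last first.
    by apply/funext => w; rewrite indicI.
  case: eqVneq => [<-|ij]; first by rewrite setIid qE.
  (* Mutual independence is used on a two-element list, duplicate-free because [i != j]. *)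
  have := Dindep [:: i; j] (fun=> C); rewrite /= inE ij => /(_ isT (fun=> mC)).
  rewrite bigcap_seq !big_cons !big_nil setIT mule1 => ->.
  by rewrite fineM ?fin_num_measure// !qE.
pose U i w : R := \1_(D i @^-1` C) w - q.
have meanU i j : has_mean P (fun w => U i w * U j w)
    (if i == j then q - q ^+ 2 else 0).
  have := has_meanD (has_meanB (mean2 i j) (has_meanZ q (mean1 i)))
    (has_meanB (has_mean_cst P (q ^+ 2)) (has_meanZ q (mean1 j))).
  congr (has_mean P _ _); first by apply/funext => w; rewrite /U; ring.
  by case: eqVneq => _; ring.
have mS n : measurable_fun [set: T]
    (fun w => sample_mean (fun i : 'I_n => \1_C (D i w) : R)).
  apply: measurable_funM => //; apply: measurable_sum => i.
  exact: (measurable_indic (mE i)).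
(* The sample size is [n.+1] so that it can be inverted; [cvg_shiftS] accounts for the shift. *)
have meanS n : has_mean P
   (fun w => (sample_mean (fun i : 'I_n.+1 => \1_C (D i w)) - q) ^+ 2)
   (n.+1%:R^-1 * (q - q ^+ 2)).
  have := has_meanZ (n.+1%:R^-1 ^+ 2) (has_mean_sum (index_enum 'I_n.+1)
    (fun i => has_mean_sum (index_enum 'I_n.+1) (fun j => meanU i j))).
  have n0 : n.+1%:R != 0 :> R by rewrite pnatr_eq0.
  congr (has_mean P _ _).
    apply/funext => w; rewrite /sample_mean.
    rewrite (_ : _ - q = n.+1%:R^-1 * \sum_(i < n.+1) U i w).
      rewrite exprMn; congr (_ * _); rewrite expr2 mulr_suml.
      by apply: eq_bigr => i _; rewrite mulr_sumr.
    rewrite /U sumrB mulrBr; congr (_ - _).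
    by rewrite sumr_const card_ord -[q *+ _]mulr_natl mulKf.
  (* Only the diagonal of the double sum is left, giving [n.+1] equal terms. *)
  under eq_bigr => i _ do rewrite -big_mkcond (big_pred1 i)//.
  by rewrite sumr_const card_ord -[_ *+ _]mulr_natl; field.
suff : P [set w | eps < `|sample_mean (fun i : 'I_n.+1 => \1_C (D i w)) - q|]
    @[n --> \oo] --> 0%E by move=> cvg0; rewrite -cvg_shiftS.
apply: (@squeeze_cvge _ _ _ _ (cst 0%E) _ (fun n =>
  ((n.+1%:R^-1 * ((q - q ^+ 2) / eps ^+ 2))%:E))).
- apply: nearW => n; rewrite measure_ge0/=.
  by rewrite mulrA; exact: chebyshev_has_mean.
- exact: cvg_cst.
- apply: cvg_EFin; first exact: nearW.
  rewrite -[0 in X in _ --> X](mul0r ((q - q ^+ 2) / eps ^+ 2)).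
  by apply: cvgM; [exact: cvg_harmonic|exact: cvg_cst].
Qed.

End convergence_in_probability.

(** * Measurability of the estimators *)

Section estimators_measurable.
Context d (T : measurableType d) (R : realType) (p K : nat).
Context (D : nat -> T -> datum R p).
Context (mD : forall i, measurable_fun [set: T] (D i)).
Context (fold : forall n, 'I_n -> 'I_K).

(** The fold assignment is not random, so for fixed [n] and [i] the training set is indexed by a
    fixed list: a random tuple of constant length, to which [measurable_procedure] applies. *)
Lemma measurable_cross_fit (fit : seq (datum R p) -> p.-tuple R -> R) n
    (i : 'I_n) : measurable_procedure fit ->
  measurable_fun [set: T] (cross_fit D fold fit i).
Proof.
move=> mfit; pose s := [seq j <- enum 'I_n | fold j != fold i].
pose sample w := map_tuple (fun j : 'I_n => D j w) (in_tuple s).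
have msample : measurable_fun [set: T] sample.
  apply/measurable_fun_tnthP => j.
  rewrite (_ : _ \o _ = D (tnth (in_tuple s) j)); first exact: mD.
  by apply/funext => w; rewrite /= tnth_map.
have mX : measurable_fun [set: T] (covariates D i).
  apply: (measurableT_comp (f := fst \o fst)) (mD i).
  exact: measurableT_comp.
exact: (measurableT_comp (mfit _) (measurable_fun_pair msample mX)).
Qed.

Let mnat : measurable_fun [set: bool] (fun b => b%:R : R).
Proof. by []. Qed.

Let mcause (i : nat) : measurable_fun [set: T] (fun w => (cause D i w)%:R : R).
Proof.
apply: (measurableT_comp mnat).
by apply: (measurableT_comp (f := snd \o fst)) (mD i); exact: measurableT_comp.
Qed.

Let moutcome (i : nat) :
  measurable_fun [set: T] (fun w => (outcome D i w)%:R : R).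
Proof. by apply: (measurableT_comp mnat); exact: measurableT_comp. Qed.

Lemma measurable_sample_mean n (f : 'I_n -> T -> R) :
  (forall i, measurable_fun [set: T] (f i)) ->
  measurable_fun [set: T] (fun w => sample_mean (fun i => f i w)).
Proof. by move=> mf; apply: measurable_funM => //; exact: measurable_sum. Qed.

Context (fit_e : seq (datum R p) -> p.-tuple R -> R)
  (fit_mu : bool -> seq (datum R p) -> p.-tuple R -> R).
Context (mfit_e : measurable_procedure fit_e)
  (mfit_mu : forall a, measurable_procedure (fit_mu a)).

Let mweighted_residual n (i : 'I_n) : measurable_fun [set: T] (fun w =>
  (cause D i w)%:R / cross_fit D fold fit_e i w *
  (1 - cross_fit D fold fit_e i w) *
  ((outcome D i w)%:R - cross_fit D fold (fit_mu true) i w)).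
Proof.
have me := measurable_cross_fit i mfit_e.
apply: measurable_funM; last first.
  by apply: measurable_funB => //; exact: measurable_cross_fit.
apply: measurable_funM; last exact: measurable_funB.
apply: measurable_funM => //.
exact: (measurableT_comp (@inv_measurable R setT)).
Qed.

Lemma measurable_mono_numerator n :
  measurable_fun [set: T] (mono_numerator D fold fit_e fit_mu n).
Proof.
apply: measurable_sample_mean => i; apply: measurable_funD.
  apply: measurable_funB => //; apply: measurable_funM => //.
  exact: measurable_funB.
apply: measurable_funM; first exact: measurable_cross_fit.
exact: measurable_funB.
Qed.

Lemma measurable_inde_numerator n :
  measurable_fun [set: T] (inde_numerator D fold fit_e fit_mu n).
Proof.
apply: measurable_sample_mean => i; apply: measurable_funB.
  apply: measurable_funM; last exact: measurable_funB.
  apply: measurable_funM; last exact: measurable_funB.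
  exact: measurable_cross_fit.
apply: measurable_funM => //; apply: measurable_funB => //.
exact: measurable_cross_fit.
Qed.

Lemma measurable_mono_denominator n :
  measurable_fun [set: T] (mono_denominator D n : T -> R).
Proof.
apply: measurable_sample_mean => i.
by apply: measurable_funM; exact: measurable_funB.
Qed.

Lemma measurable_inde_denominator n :
  measurable_fun [set: T] (inde_denominator D n : T -> R).
Proof.
apply: measurable_sample_mean => i.
by apply: measurable_funM; exact: measurable_funB.
Qed.

End estimators_measurable.

(** * Consistency of the two ratio estimators *)

Theorem proposition3 (R : realType) (d : measure_display)
  (T : measurableType d) (P : probability T R) (p K : nat)
  (X : {RV P >-> p.-tuple R}) (A Y Y0 Y1 : {RV P >-> bool})
  (D : nat -> {RV P >-> datum R p})
  (fold : forall n, 'I_n -> 'I_K)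
  (fit_e : seq (datum R p) -> p.-tuple R -> R)
  (fit_mu : bool -> seq (datum R p) -> p.-tuple R -> R)
  (e ebar : p.-tuple R -> R) (mu mbar : bool -> p.-tuple R -> R)
  (consistency : forall w, (Y w)%:R =
     (A w)%:R * (Y1 w)%:R + (1 - (A w)%:R) * (Y0 w)%:R :> R)
  (pos_A_Y_false : (0 < P [set w | A w = false /\ Y w = false])%E)
  (e_propensity : is_cond_prob P X [set w | A w = true] e)
  (mu_regression : is_cond_prob P (fun w => (X w, A w)) [set w | Y w = true]
     (fun xa => mu xa.2 xa.1))
  (sampling : iid_copies P (fun i => D i : T -> datum R p)
     (fun w => (X w, A w, Y w)))
  (folds : equal_folds fold)
  (fit_e_meas : measurable_procedure fit_e)
  (fit_mu_meas : forall a, measurable_procedure (fit_mu a))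
  (ebar_meas : measurable_fun [set: p.-tuple R] ebar)
  (mbar_meas : forall a, measurable_fun [set: p.-tuple R] (mbar a))
  (ebar_01 : forall x, 0 < ebar x < 1)
  (ignorability : cond_indep P X (fun w => (Y0 w, Y1 w)) A)
  (overlap : forall x, 0 < e x < 1) :
  let gamma := cond_pr P [set w | Y1 w = true]
                 [set w | A w = false /\ Y w = false] in
  let propensity_correct := forall x, ebar x = e x in
  let outcome_correct := forall a x, mbar a x = mu a x in
  ({ae P, forall w, (Y0 w <= Y1 w)%N} ->
   cvg_in_prob_to_mean P (mono_numerator D fold fit_e fit_mu)
     (fun w => mono_summand (ebar (X w)) (mbar true (X w)) (A w) (Y w)) ->
   propensity_correct \/ outcome_correct ->
   cvg_in_prob P (gamma_mono D fold fit_e fit_mu) gamma)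
  /\
  (cond_indep P X Y0 Y1 ->
   cvg_in_prob_to_mean P (inde_numerator D fold fit_e fit_mu)
     (fun w => inde_summand (ebar (X w)) (mbar false (X w)) (mbar true (X w))
        (A w) (Y w)) ->
   outcome_correct ->
   cvg_in_prob P (gamma_inde D fold fit_e fit_mu) gamma).
Proof.
move=> gamma propensity_correct outcome_correct.
have mX : measurable_fun [set: T] X by [].
have mA : measurable_fun [set: T] A by [].
have mY : measurable_fun [set: T] Y by [].
have mY0 : measurable_fun [set: T] Y0 by [].
have mY1 : measurable_fun [set: T] Y1 by [].
have mD i : measurable_fun [set: T] (D i) by [].
have YE w : Y w = if A w then Y1 w else Y0 w.
  have /eqP := consistency w; case: (A w).
    by rewrite subrr mul1r mul0r addr0 eqr_nat; case: (Y w); case: (Y1 w).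
  by rewrite subr0 mul0r mul1r add0r eqr_nat; case: (Y w); case: (Y0 w).
(* Both denominators tend to [- q], nonzero by positivity. *)
pose q : R := fine (P [set w | A w = false /\ Y w = false]).
have untreatedE (T' : Type) (a y : T' -> bool) :
    [set z | a z = false /\ y z = false] = [set z | ~~ a z && ~~ y z = true].
  apply/seteqP; split=> z /=; first by case=> -> ->.
  by move=> /andP[/negbTE -> /negbTE ->].
have q0 : - q != 0.
  rewrite oppr_eq0 gt_eqF// fine_gt0// pos_A_Y_false/= ltey_eq.
  rewrite fin_num_measure// untreatedE; apply: measurable_eq_true.
  by apply: measurable_and; exact: measurable_neg.
pose g : R := fine (P [set w | (~~ Y0 w && Y1 w) && ~~ A w = true]).
(* On [A = 0] the observed [Y] is [Y0], so [g] is the numerator of [gamma]; the two signs match the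
   limits of the estimators. *)
have gammaE : gamma = - g / - q.
  rewrite invrN mulrNN /gamma /cond_pr; congr (fine (P _) / _).
  apply/seteqP; split=> w /=; rewrite YE.
    by case=> -> [-> ->].
  by case: (A w) => //=; rewrite ?andbF// andbT => /andP[/negbTE -> ->].
(* The event in the space of observations whose indicator is minus each denominator summand. *)
pose C : set (datum R p) := [set z | z.1.2 = false /\ z.2 = false].
have mC : measurable C.
  rewrite /C untreatedE; apply: measurable_eq_true.
  apply: measurable_and; apply: measurable_neg => //.
  exact: (measurableT_comp (f := snd)).
have indC i w : \1_C (D i w) = (~~ cause D i w && ~~ outcome D i w)%:R :> R.
  by rewrite /C untreatedE indic_eq_true.
(* Common to both parts: the weak law for [C] handles the denominator, so only the limit of the
   numerator remains. *)
have ratio (V W : nat -> T -> R) :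
    (forall n, measurable_fun [set: T] (V n)) ->
    (forall n, measurable_fun [set: T] (W n)) ->
    (forall n w, W n w = - sample_mean (fun i : 'I_n => \1_C (D i w))) ->
    cvg_in_prob P V (- g) -> cvg_in_prob P (fun n w => V n w / W n w) gamma.
  move=> mV mW WE Vg; rewrite gammaE; apply: cvg_in_prob_div => // eps eps0.
  rewrite (_ : (fun n => _) = (fun n =>
    P [set w | eps < `|sample_mean (fun i : 'I_n => \1_C (D i w)) - q|])).
    exact: (weak_law_indic mD sampling mC).
  apply/funext => n; congr (P _); apply: eq_set => w.
  by rewrite WE -opprD normrN.
split=> [Y01 [phii numerator] correct|Y01 [phii numerator] correct].
- apply: ratio.
  + by move=> n; exact: measurable_mono_numerator.
  + by move=> n; exact: measurable_mono_denominator.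
  + move=> n w; rewrite /mono_denominator /sample_mean -mulrN -sumrN.
    congr (_ * _); apply: eq_bigr => i _; rewrite indC.
    by case: (cause _ _ _); case: (outcome _ _ _) => /=; ring.
  (* The assumed limit is the expectation of the limiting summand; it remains to evaluate it as
     [- g]. *)
  move: numerator; congr (cvg_in_prob P _ _); apply: has_mean_fine.
  rewrite -(untreated_pr_monotone mA mY0 mY1 Y01).
  case: correct => correct.
    have ebarE : ebar = e by exact/funext.
    rewrite ebarE in phii *.
    exact: (mono_mean_propensity mX mA mY0 mY1 YE e_propensity ignorability
      overlap (mbar_meas true) phii).
  have mbarE : mbar = mu by apply/funext => a; exact/funext.
  rewrite mbarE in phii *.
  exact: (mono_mean_outcome mX mA mY mY0 mY1 YE e_propensity mu_regression
    ignorability overlap ebar_meas phii).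
- apply: ratio.
  + by move=> n; exact: measurable_inde_numerator.
  + by move=> n; exact: measurable_inde_denominator.
  + move=> n w; rewrite /inde_denominator /sample_mean -mulrN -sumrN.
    congr (_ * _); apply: eq_bigr => i _; rewrite indC.
    by case: (cause _ _ _); case: (outcome _ _ _) => /=; ring.
  move: numerator; congr (cvg_in_prob P _ _); apply: has_mean_fine.
  have mbarE : mbar = mu by apply/funext => a; exact/funext.
  have mm0 := mbar_meas false; rewrite mbarE in phii mm0 *.
  exact: (inde_mean_outcome mX mA mY mY0 mY1 YE e_propensity mu_regression
    ignorability overlap Y01 ebar_meas mm0 phii).
Qed.
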